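(* Let $H:\mathbb{R}^{2n}\to\mathbb{R}$ be smooth, $f=J_n^{-1}\nabla H$, $x_0\in\mathbb{R}^{2n}$, and $A=Df(x_0)$. Let $U\in\mathbb{R}^{2n\times2k}$ be a matrix produced (without breakdown) by any one of the three symplectic Krylov processes described in the context (symplectic Arnoldi, isotropic Arnoldi, Hamiltonian Lanczos), applied to $A$ and some nonzero starting vector $v\in\mathbb{R}^{2n}$. Consider the Hamiltonian system in $\mathbb{R}^{2k}$ with Hamiltonian $\eta(\xi)=H(x_0+U\xi)$, namely $$\xi'(t)=J_k^{-1}\nabla\eta(\xi(t))=U^\dagger f(x_0+U\xi(t)),\qquad \xi(0)=0,\qquad U^\dagger=J_k^{-1}U^TJ_n .$$ If a numerical method applied to this small system produces from $\xi_0=0$ a value $\xi_1\in\mathbb{R}^{2k}$ and preserves its energy, i.e. $\eta(\xi_1)=\eta(\xi_0)$, then $x_1:=x_0+U\xi_1$ satisfies $H(x_1)=H(x_0)$, i.e. the energy of the original system $x'=f(x)$ is preserved as well.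
   Context: For a positive integer $m$, $J_m=\begin{bmatrix}0&I_m\\-I_m&0\end{bmatrix}$; write $J=J_n$. A matrix $U\in\mathbb{R}^{2n\times 2k}$ is symplectic if $U^TJ_nU=J_k$. $\langle\cdot,\cdot\rangle$ and $\|\cdot\|$ are the Euclidean inner product and norm. The matrix $A=Df(x_0)$ is Hamiltonian ($A^T=JAJ$). The three processes, each yielding a symplectic $U\in\mathbb{R}^{2n\times2k}$ when no division by zero occurs, are: (1) Symplectic Arnoldi. Set $q=v/\|v\|$, $Q=[q]$, $V=[q]$. For $j=2,\dots,k$: put $r=Aq$, replace $r$ by $r-QQ^Tr$; if $r\neq0$ set $q=r/\|r\|$, $Q\leftarrow[Q,q]$, then $r=q-VV^Tq-JVV^TJ^Tq$ and $V\leftarrow[V,r/\|r\|]$; otherwise stop. Finally $U=[V\ \ J^{-1}V]$. (2) Isotropic Arnoldi. Set $q=v/\|v\|$, $Q=[q]$. For $j=2,\dots,k$: put $r=Aq$, replace $r$ by $r-QQ^Tr-JQQ^TJ^Tr$; if $r\ne0$ set $q=r/\|r\|$ and $Q\leftarrow[Q,q]$; otherwise stop. Finally $U=[Q\ \ J^{-1}Q]$. (3) Hamiltonian Lanczos. Set $u^0=0$, $u^1=v/\|v\|$, $\beta_0=0$. For $j=0,1,\dots,k$: if $j>0$, put $y=Av^j$, $\alpha_j=\langle Jv^j,y\rangle$, $u^{j+1}=y-\alpha_ju^j-\beta_{j-1}u^{j-1}$; if $j<k$, put $v^{j+1}=Au^{j+1}$, $\tau=\langle Jv^{j+1},u^{j+1}\rangle$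 (breakdown if $\tau=0$), $\sigma=\sqrt{|\tau|}$, $\delta_{j+1}=\operatorname{sgn}\tau$, $u^{j+1}\leftarrow u^{j+1}/\sigma$, $v^{j+1}\leftarrow\delta_{j+1}v^{j+1}/\sigma$, and if $j>0$ set $\beta_j=\sigma$. Finally $U=[u^1,\dots,u^k,v^1,\dots,v^k]$. *)

(* Defs.v *)
From mathcomp Require Export all_boot all_order all_algebra.
From mathcomp Require Export all_classical all_reals all_analysis.
Export Order.TTheory GRing.Theory Num.Theory.
Export numFieldNormedType.Exports.

Set Implicit Arguments.
Unset Strict Implicit.
Unset Printing Implicit Defensive.

Local Open Scope ring_scope.

(* R^{2m} is ['cV[R]_(m + m)], so that block matrices need no casts.  Its
   library norm is the sup norm, used only through the topology it induces;
   the Euclidean inner product and norm are [dotp] and [enorm]. *)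

Definition dotp (R : realType) (m : nat) (x y : 'cV[R]_m) : R :=
  \sum_(i < m) x i ord0 * y i ord0.

Definition enorm (R : realType) (m : nat) (x : 'cV[R]_m) : R :=
  Num.sqrt (dotp x x).

Definition normalize (R : realType) (m : nat) (x : 'cV[R]_m) : 'cV[R]_m :=
  (enorm x)^-1 *: x.

Definition Jmx (R : realType) (m : nat) : 'M[R]_(m + m) :=
  block_mx 0 1%:M (- 1%:M) 0.
Arguments Jmx {R} m.

(* [class_C p F]: F is p times continuously differentiable.  In finite
   dimension, F is C^{p+1} iff it is differentiable and all its directional
   derivatives are C^p. *)
Fixpoint class_C (R : realType) (V W : normedModType R) (p : nat)
    (F : V -> W) : Prop :=
  match p with
  | 0 => continuous F
  | p'.+1 => (forall x : V, differentiable F x) /\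
             (forall w : V, class_C p' (fun x : V => 'D_w F x))
  end.

Definition smooth (R : realType) (V W : normedModType R) (F : V -> W) : Prop :=
  forall p : nat, class_C p F.

Definition grad (R : realType) (m : nat) (F : 'cV[R]_m -> R) (x : 'cV[R]_m) :
    'cV[R]_m :=
  \col_i 'D_(delta_mx i ord0) F x.

(* The library's [jacobian] is for row vectors and acts on the right; here
   Df(x) multiplies columns on the left. *)
Definition Dmx (R : realType) (m p : nat) (f : 'cV[R]_m -> 'cV[R]_p)
    (x : 'cV[R]_m) : 'M[R]_(p, m) :=
  \matrix_(i, j) ('D_(delta_mx j ord0) f x) i ord0.

Definition ham_field (R : realType) (m : nat) (H : 'cV[R]_(m + m) -> R)
    (x : 'cV[R]_(m + m)) : 'cV[R]_(m + m) :=
  invmx (Jmx m) *m grad H x.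

(* U^dagger = J_k^{-1} U^T J_n *)
Definition sympl_inv (R : realType) (n k : nat) (U : 'M[R]_(n + n, k + k)) :
    'M[R]_(k + k, n + n) :=
  invmx (Jmx k) *m U^T *m Jmx n.

(* In the three runs below, index [j] is the number of columns computed so
   far; every division by zero is excluded by a premise.  In the two Arnoldi
   processes, "otherwise stop" at r = 0 ends the loop with the columns found
   so far, so an early stop is a run with a smaller index. *)

(* [symplectic_arnoldi_run A v j q Q V]: current q, Q and V. *)
Inductive symplectic_arnoldi_run (R : realType) (n : nat) (A : 'M[R]_(n + n))
    (v : 'cV[R]_(n + n)) : forall j : nat,
    'cV[R]_(n + n) -> 'M[R]_(n + n, j) -> 'M[R]_(n + n, j) -> Prop :=
| SArnoldiStart : v != 0 ->
    symplectic_arnoldi_run A v (normalize v) (normalize v) (normalize v)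
| SArnoldiStep (j : nat) (q : 'cV[R]_(n + n)) (Q V : 'M[R]_(n + n, j)) :
    symplectic_arnoldi_run A v q Q V ->
    let r := A *m q - Q *m Q^T *m (A *m q) in
    r != 0 ->
    let q' := normalize r in
    let r' := q' - V *m V^T *m q' - Jmx n *m V *m V^T *m (Jmx n)^T *m q' in
    r' != 0 ->
    symplectic_arnoldi_run A v q' (row_mx Q q') (row_mx V (normalize r')).

Definition symplectic_arnoldi (R : realType) (n k : nat) (A : 'M[R]_(n + n))
    (v : 'cV[R]_(n + n)) (U : 'M[R]_(n + n, k + k)) : Prop :=
  exists (q : 'cV[R]_(n + n)) (Q V : 'M[R]_(n + n, k)),
    symplectic_arnoldi_run A v q Q V /\
    U = row_mx V (invmx (Jmx n) *m V).

(* [isotropic_arnoldi_run A v j q Q]: current q and Q. *)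
Inductive isotropic_arnoldi_run (R : realType) (n : nat) (A : 'M[R]_(n + n))
    (v : 'cV[R]_(n + n)) : forall j : nat,
    'cV[R]_(n + n) -> 'M[R]_(n + n, j) -> Prop :=
| IArnoldiStart : v != 0 ->
    isotropic_arnoldi_run A v (normalize v) (normalize v)
| IArnoldiStep (j : nat) (q : 'cV[R]_(n + n)) (Q : 'M[R]_(n + n, j)) :
    isotropic_arnoldi_run A v q Q ->
    let y := A *m q in
    let r := y - Q *m Q^T *m y - Jmx n *m Q *m Q^T *m (Jmx n)^T *m y in
    r != 0 ->
    isotropic_arnoldi_run A v (normalize r) (row_mx Q (normalize r)).

Definition isotropic_arnoldi (R : realType) (n k : nat) (A : 'M[R]_(n + n))
    (v : 'cV[R]_(n + n)) (U : 'M[R]_(n + n, k + k)) : Prop :=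
  exists (q : 'cV[R]_(n + n)) (Q : 'M[R]_(n + n, k)),
    isotropic_arnoldi_run A v q Q /\
    U = row_mx Q (invmx (Jmx n) *m Q).

(* Second half of a Lanczos iteration, as functions of the unscaled vector
   [ut] = u^{j+1}: tau, sigma, and the final u^{j+1} and v^{j+1}. *)
Definition lanczos_tau (R : realType) (n : nat) (A : 'M[R]_(n + n))
    (ut : 'cV[R]_(n + n)) : R :=
  dotp (Jmx n *m (A *m ut)) ut.

Definition lanczos_sigma (R : realType) (n : nat) (A : 'M[R]_(n + n))
    (ut : 'cV[R]_(n + n)) : R :=
  Num.sqrt `|lanczos_tau A ut|.

Definition lanczos_u (R : realType) (n : nat) (A : 'M[R]_(n + n))
    (ut : 'cV[R]_(n + n)) : 'cV[R]_(n + n) :=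
  (lanczos_sigma A ut)^-1 *: ut.

Definition lanczos_v (R : realType) (n : nat) (A : 'M[R]_(n + n))
    (ut : 'cV[R]_(n + n)) : 'cV[R]_(n + n) :=
  (Num.sg (lanczos_tau A ut) / lanczos_sigma A ut) *: (A *m ut).

(* [lanczos_run A w Us Vs u0 u v b]: Us = [u^1 .. u^j], Vs = [v^1 .. v^j],
   u0 = u^{j-1}, u = u^j, v = v^j, b = beta_{j-1}.  The last iteration j = k
   of the loop only computes an unscaled u^{k+1}, which does not enter U and
   involves no division; it is omitted. *)
Inductive lanczos_run (R : realType) (n : nat) (A : 'M[R]_(n + n))
    (w : 'cV[R]_(n + n)) : forall j : nat,
    'M[R]_(n + n, j) -> 'M[R]_(n + n, j) ->
    'cV[R]_(n + n) -> 'cV[R]_(n + n) -> 'cV[R]_(n + n) -> R -> Prop :=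
| LanczosStart : w != 0 ->
    let ut := normalize w in
    lanczos_tau A ut != 0 ->
    lanczos_run A w (lanczos_u A ut) (lanczos_v A ut)
      0 (lanczos_u A ut) (lanczos_v A ut) 0
| LanczosStep (j : nat) (Us Vs : 'M[R]_(n + n, j))
    (u0 u v : 'cV[R]_(n + n)) (b : R) :
    lanczos_run A w Us Vs u0 u v b ->
    let y := A *m v in
    let alpha := dotp (Jmx n *m v) y in
    let ut := y - alpha *: u - b *: u0 in
    lanczos_tau A ut != 0 ->
    lanczos_run A w (row_mx Us (lanczos_u A ut)) (row_mx Vs (lanczos_v A ut))
      u (lanczos_u A ut) (lanczos_v A ut) (lanczos_sigma A ut).

Definition hamiltonian_lanczos (R : realType) (n k : nat) (A : 'M[R]_(n + n))
    (w : 'cV[R]_(n + n)) (U : 'M[R]_(n + n, k + k)) : Prop :=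
  exists (Us Vs : 'M[R]_(n + n, k)) (u0 u v : 'cV[R]_(n + n)) (b : R),
    lanczos_run A w Us Vs u0 u v b /\ U = row_mx Us Vs.

(* The initial value problem xi' = ivp_field xi, xi(0) = ivp_init. *)
Record ivp (R : realType) (m : nat) := IVP {
  ivp_field : 'cV[R]_m -> 'cV[R]_m;
  ivp_init : 'cV[R]_m
}.

(* [Phi m P h xi1]: applied to P with step size h, the method produces xi1
   from the initial value of P.  A relation, so that implicit methods, whose
   equations may have no or several solutions, are covered. *)
Definition numerical_method (R : realType) :=
  forall m : nat, ivp R m -> R -> 'cV[R]_m -> Prop.

(* Main.v *)
(* The chain rule gives grad eta (xi) = U^T grad H (x0 + U xi), and J_n cancels
   in U^dagger J_n^{-1} = J_k^{-1} U^T, so the two forms of the small system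
   agree; energy is transferred because eta is the restriction of H to
   x0 + im U, with eta 0 = H x0. *)
Require Import Defs.
Local Open Scope ring_scope.

(** Since [J] squares to minus the identity, [- Jmx m] is its inverse. *)
Lemma Jmx_unit (R : realType) (m : nat) : (Jmx m : 'M[R]_(m + m)) \in unitmx.
Proof.
suff /mulmx1_unit[] : Jmx m *m (- Jmx m) = 1%:M :> 'M[R]_(m + m) by [].
rewrite mulmxN /Jmx mulmx_block !mul0mx !mulmx0 !mul1mx mulmx1 !addr0 !add0r.
by rewrite opp_block_mx opprK oppr0 -scalar_mx_block.
Qed.

(** Both difference quotients are the same function of the step, so the equality holds whether or
    not the limits exist. *)
Lemma derive_comp_affine (R : realType) (m p : nat) (F : 'cV[R]_m -> R)
    (a : 'cV[R]_m) (B : 'M[R]_(m, p)) (w x : 'cV[R]_p) :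
  'D_w (fun y => F (a + B *m y)) x = 'D_(B *m w) F (a + B *m x).
Proof.
rewrite /derive; set g := (X in fmap X _).
set g' := (X in _ = lim (fmap X _)); suff -> : g = g' by [].
by apply/funext => h; rewrite /g /g' /= mulmxDr -scalemxAr addrCA.
Qed.

(** Differentiability makes ['D_w F x] linear in [w], which is then expanded in the standard
    basis. *)
Lemma derive_grad (R : realType) (m : nat) (F : 'cV[R]_m -> R)
    (w x : 'cV[R]_m) :
  differentiable F x -> 'D_w F x = \sum_i w i ord0 * grad F x i ord0.
Proof.
move=> dF; rewrite deriveE // [in LHS](matrix_sum_delta w) linear_sum /=.
by apply: eq_bigr => i _; rewrite big_ord1 linearZ /= mxE deriveE.
Qed.

Lemma grad_comp_affine (R : realType) (m p : nat) (F : 'cV[R]_m -> R)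
    (a : 'cV[R]_m) (B : 'M[R]_(m, p)) (x : 'cV[R]_p) :
  differentiable F (a + B *m x) ->
  grad (fun y => F (a + B *m y)) x = B^T *m grad F (a + B *m x).
Proof.
move=> dF; apply/colP => i.
rewrite [LHS]mxE derive_comp_affine derive_grad // [RHS]mxE.
(* [B *m delta_mx i ord0] is column [i] of [B], that is, row [i] of [B^T]. *)
by apply: eq_bigr => j _; rewrite -colE !mxE.
Qed.

Theorem proposition7 (R : realType) (n k : nat) (n_gt0 : (0 < n)%N)
    (k_gt0 : (0 < k)%N)
    (H : 'cV[R]_(n + n) -> R) (H_smooth : smooth H)
    (x0 v : 'cV[R]_(n + n)) (v_neq0 : v != 0)
    (U : 'M[R]_(n + n, k + k)) :
  let f := ham_field H in
  let A := Dmx f x0 in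
  symplectic_arnoldi A v U \/ isotropic_arnoldi A v U
    \/ hamiltonian_lanczos A v U ->
  let eta := fun xi : 'cV[R]_(k + k) => H (x0 + U *m xi) in
  let small_system := IVP (ham_field eta) 0 in
  (forall xi : 'cV[R]_(k + k),
     ivp_field small_system xi = sympl_inv U *m f (x0 + U *m xi))
  /\
  (forall (Phi : numerical_method R) (h : R) (xi1 : 'cV[R]_(k + k)),
     Phi (k + k)%N small_system h xi1 ->
     eta xi1 = eta (ivp_init small_system) ->
     let x1 := x0 + U *m xi1 in
     H x1 = H x0).
Proof.
move=> f A _ eta small_system; split=> [xi|Phi h xi1 _].
  rewrite /= /f /ham_field /sympl_inv -!mulmxA.
  rewrite (mulKVmx (Jmx_unit R n)) grad_comp_affine //.
  (* The chain rule asks for differentiability of [H], the first component of class [C^1]. *)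
  exact: (H_smooth 1%N).1.
by rewrite /eta /= mulmx0 addr0.
Qed.
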